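(* Let $\mathbb{F}$ be a field and let $K$ be a finite simplicial complex with a filtration $K_1\le K_2\le\dots\le K_m=K$ in which $K_1=\{\sigma_1\}$ and each $K_i$ with $i\geq 2$ is obtained from $K_{i-1}$ by adding a single simplex $\sigma_i$. For each dimension $k$ let $\partial_k$ be the $k$-dimensional boundary matrix over $\mathbb{F}$, and let $D_k$ be the submatrix of $\partial_k$ consisting of all rows of $\partial_k$ and exactly those columns that correspond to death $k$-simplices and essential $k$-simplices (with columns kept in the same order and labelled by the same simplices). Then the persistent homology representatives obtained by applying the column reduction algorithm to $D_k$ are the same as those obtained by applying the column reduction algorithm to $\partial_k$. That is: for every death $k$-simplex $\sigma_i$, the column labelled by $\sigma_i$ in the reduced form of $D_k$ equals the column labelled by $\sigma_i$ in the reduced form of $\partial_k$; and for every essential $k$-simplex $\sigma_i$, the representative cycle of $\sigma_i$ obtained from the reduction of $D_k$ equals the one obtained from the reduction of $\partial_k$.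
   Context: Chains are simplicial chains with coefficients in $\mathbb{F}$. The matrix $\partial_k$ represents the boundary map from $k$-chains to $(k-1)$-chains; its columns are labelled by the $k$-simplices and its rows by the $(k-1)$-simplices of $K$, both in increasing order of the filtration index (the boundary of a vertex is $0$). Put $K_0=\emptyset$. Column reduction algorithm. For a matrix $A$, let $\mathrm{Low}_A(i)$ denote the label of the lowest nonzero entry of the column labelled $i$, or $0$ if the column is zero. The columns are processed from left to right. When processing column $i$: as long as there is an earlier column $j$ (left of $i$, already reduced) with $\mathrm{Low}(j)=\mathrm{Low}(i)\ne0$, replace column $i$ by column $i$ minus $\lambda$ times column $j$, where $\lambda$ is the quotient of the lowest nonzero entry of column $i$ by that of column $j$. (Nonzero already reduced columns have distinct $\mathrm{Low}$ values, so $j$ is unique at each step and the algorithm is deterministic.) Tracking of column operations. To each column $i$ attach the chain $v_i$, initially $v_i=\sigma_i$; whenever column $i$ is replaced by column $i$ minus $\lambda$ times column $j$, replace $v_i$ by $v_i-\lambda v_j$. Thus at every stage column $i$ is the boundary of $v_i$, and at the end $v_i=\sigma_i-\sum_{j<i}\lambda_j\sigma_j$ for some $\lambda_j\in\mathbb{F}$. Death, birth and essential simplices. A simplex $\sigma_i$ is a death simplex if $\partial\sigma_i$ is not an $\mathbb{F}$-linear combination of boundaries of simplices in $K_{i-1}$; otherwise it is a birth simplex. Let $\partial_k'$ be the reduced form of $\partial_k$. Whenever the column of $\partial_k'$ labelled by $\sigma_i$ is nonzero, $\sigma_i$ is a death simplex and forms a persistence pair with the birth $(k-1)$-simplex labelling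 the lowest nonzero entry of that column. A birth simplex not contained in any persistence pair (for any $k$) is called essential. Representatives. The representative of a persistence pair with death simplex $\sigma_i$ is the reduced column labelled by $\sigma_i$, viewed as a $(k-1)$-chain. The representative of an essential simplex $\sigma_i$, whose column is reduced to zero, is the cycle given by the final value of $v_i=\sigma_i-\sum_{j<i}\lambda_j\sigma_j$. *)

(* Defs.v *)
From HB Require Import structures.
From mathcomp Require Import all_boot all_order all_algebra.

Set Implicit Arguments.
Unset Strict Implicit.
Unset Printing Implicit Defensive.

Import GRing.Theory.
Local Open Scope ring_scope.

Section Reduction.

Variable F : fieldType.

(* Row position of the lowest (largest index) nonzero entry; None for the zero
   column. *)
Definition low (p : nat) (c : 'cV[F]_p) : option 'I_p :=
  [pick r | (c r 0 != 0) && [forall s : 'I_p, (r < s)%N ==> (c s 0 == 0)]].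

Definition lowest_entry (p : nat) (c : 'cV[F]_p) : F :=
  if low c is Some r then c r 0 else 0.

Definition sub_col (p q : nat) (i j : 'I_q) (lam : F) (A : 'M[F]_(p, q)) :=
  \matrix_(r, c) (if c == i then A r i - lam * A r j else A r c).

Definition earlier_same_low (p q : nat) (A : 'M[F]_(p, q)) (i : 'I_q) :
    option 'I_q :=
  [pick j : 'I_q |
    [&& (j < i)%N, low (col j A) == low (col i A) & low (col i A) != None]].

(* A state (A, W) consists of the current matrix A and the matrix W whose i-th
   column is the chain v_i attached to column i of A. *)
Definition reduction_step (p q n : nat) (i : 'I_q)
    (S : 'M[F]_(p, q) * 'M[F]_(n, q)) : 'M[F]_(p, q) * 'M[F]_(n, q) :=
  if earlier_same_low S.1 i is Some j then
    let lam := lowest_entry (col i S.1) / lowest_entry (col j S.1) in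
    (sub_col i j lam S.1, sub_col i j lam S.2)
  else S.

(* Each effective step strictly raises the lowest nonzero entry of column i, or
   makes the column zero; so p steps always reach the end of the loop, after
   which reduction_step is the identity. *)
Definition reduce_column (p q n : nat) (i : 'I_q)
    (S : 'M[F]_(p, q) * 'M[F]_(n, q)) : 'M[F]_(p, q) * 'M[F]_(n, q) :=
  iter p (reduction_step i) S.

Definition column_reduction (p q n : nat)
    (S : 'M[F]_(p, q) * 'M[F]_(n, q)) : 'M[F]_(p, q) * 'M[F]_(n, q) :=
  foldl (fun T i => reduce_column i T) S (enum 'I_q).

End Reduction.

Section Filtration.

Variables (disp : Order.disp_t) (V : finOrderType disp).

Definition simplicial_complex (K : {set {set V}}) : Prop :=
  set0 \notin K /\
  forall s t : {set V}, s \in K -> t \subset s -> t != set0 -> t \in K.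

(* The simplices are indexed from 0: [sigma i] is the simplex added when passing
   from [Kf i] to [Kf i.+1]. *)
Record simplexwise_filtration (K : {set {set V}}) (m : nat)
    (Kf : nat -> {set {set V}}) (sigma : 'I_m -> {set V}) : Prop := {
  filtration_gt0 : (0 < m)%N;
  filtration_start : Kf 0%N = set0;
  filtration_end : Kf m = K;
  filtration_complex : forall i : 'I_m, simplicial_complex (Kf i.+1);
  filtration_new : forall i : 'I_m, sigma i \notin Kf i;
  filtration_step : forall i : 'I_m, Kf i.+1 = sigma i |: Kf i
}.

Variables (F : fieldType) (m : nat).
Variables (Kf : nat -> {set {set V}}) (sigma : 'I_m -> {set V}).

(* Coefficient of t in the boundary of s, where s = {v_0 < ... < v_k} is oriented
   by the order of V: the sum over j with t = s minus v_j of (-1)^j. *)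
Definition incidence (t s : {set V}) : F :=
  \sum_(v in s | t == s :\ v) (-1) ^+ #|[set w in s | (w < v)%O]|.

(* Boundary matrix on chains of all dimensions. As the empty set is not a simplex,
   the column of a vertex is 0. *)
Definition total_boundary : 'M[F]_m :=
  \matrix_(i, j) incidence (sigma i) (sigma j).

(* Indices of the simplices with c vertices, i.e. of dimension c - 1. *)
Definition simplices (c : nat) : {set 'I_m} := [set i | #|sigma i| == c].

(* [enum_val] lists a set of ordinals in increasing order; it labels the rows and
   columns by filtration indices. For k = 0 there are no rows. *)
Definition boundary_matrix (k : nat) :
    'M[F]_(#|simplices k|, #|simplices k.+1|) :=
  mxsub enum_val enum_val total_boundary.

Definition reduced_boundary (k : nat) :=
  column_reduction (boundary_matrix k, 1%:M : 'M[F]_#|simplices k.+1|).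

Definition death (i : 'I_m) : bool :=
  col i total_boundary \notin
    <<[seq col j total_boundary | j <- enum 'I_m & sigma j \in Kf i]>>%VS.

Definition birth (i : 'I_m) : bool := ~~ death i.

(* The pair (b, d) comes from the column labelled d of the reduced form of the
   k-th boundary matrix. *)
Definition persistence_pair (k : nat) (b d : 'I_m) : bool :=
  [exists c : 'I_#|simplices k.+1|,
    (enum_val c == d) &&
    (omap enum_val (low (col c (reduced_boundary k).1)) == Some b)].

(* Every simplex has dimension less than #|V|, so all dimensions are covered. *)
Definition paired (i : 'I_m) : bool :=
  [exists k : 'I_#|V|, exists b : 'I_m, exists d : 'I_m,
    persistence_pair k b d && ((i == b) || (i == d))].

Definition essential (i : 'I_m) : bool := birth i && ~~ paired i.

Definition kept_columns (k : nat) : {set 'I_#|simplices k.+1|} :=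
  [set c | death (enum_val c) || essential (enum_val c)].

Definition D_matrix (k : nat) : 'M[F]_(#|simplices k|, #|kept_columns k|) :=
  colsub enum_val (boundary_matrix k).

(* The chains v_i are k-chains of the whole complex, also for the columns of
   [D_matrix k]. *)
Definition reduced_D (k : nat) :=
  column_reduction
    (D_matrix k, colsub enum_val (1%:M : 'M[F]_#|simplices k.+1|)).

Definition boundary_label (k : nat) (a : 'I_#|simplices k.+1|) : 'I_m :=
  enum_val a.

Definition D_label (k : nat) (b : 'I_#|kept_columns k|) : 'I_m :=
  boundary_label (enum_val b).

End Filtration.

(* Main.v *)
(* The reduction never uses a zero column to modify another one, so columns that
   are reduced to zero may be deleted without affecting the rest of the run. A
   deleted column is a birth column: its boundary is a combination of earlier
   ones. Column operations preserve the span of every initial segment of columns,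
   so the reduced column is still a combination of the earlier reduced columns;
   as nonzero reduced columns have distinct lows, they are linearly independent
   and the column must be zero. *)
Require Import Defs.
From HB Require Import structures.
From mathcomp Require Import all_boot all_order all_algebra.

Section Reduction.

Set Implicit Arguments.
Unset Strict Implicit.
Unset Printing Implicit Defensive.

Import GRing.Theory.
Local Open Scope ring_scope.

(** * Increasing enumerations of ordinals *)

Lemma ord_ltn_trans (n : nat) : transitive (fun a b : 'I_n => (a < b)%N).
Proof. by move=> a b c; apply: ltn_trans. Qed.

Lemma sorted_enum_ord (n : nat) (A : pred 'I_n) :
  sorted (fun a b : 'I_n => (a < b)%N) (enum A).
Proof.
rewrite /enum_mem -enumT; apply: sorted_filter; first exact: ord_ltn_trans.
by have := iota_ltn_sorted 0 n; rewrite -val_enum_ord sorted_map.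
Qed.

Lemma pick_ord_min (n : nat) (P : pred 'I_n) (x y : 'I_n) :
  [pick z | P z] = Some x -> P y -> (x <= y)%N.
Proof.
rewrite /pick /=; have := mem_enum P y; move: (sorted_enum_ord P).
case: (enum P) => [|z s] //= sorted_s memy [<-] Py.
move: memy; rewrite [y \in P]Py inE => /predU1P[-> // | ys].
have /allP/(_ y ys) := order_path_min (@ord_ltn_trans n) sorted_s.
exact: ltnW.
Qed.

(** Since [enum] of a set of ordinals is strictly increasing, [enum_val] is an order embedding. This
    is what makes the kept columns an instance of the monotone selections [f] considered below. *)
Lemma enum_val_ltn (n : nat) (A : {set 'I_n}) (i j : 'I_#|A|) :
  (enum_val i < enum_val j)%N = (i < j)%N.
Proof.
have mono (a b : 'I_#|A|) : (a < b)%N -> (enum_val a < enum_val b)%N.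
  move=> ab; rewrite (enum_val_nth (enum_val a) a) (enum_val_nth (enum_val a) b).
  by apply: (sorted_ltn_nth (@ord_ltn_trans n)) => //;
     rewrite ?sorted_enum_ord // inE -cardE ltn_ord.
apply/idP/idP => [|/mono //]; rewrite !ltnNge; apply: contra.
by rewrite leq_eqVlt => /predU1P[/val_inj -> // | /mono /ltnW].
Qed.

(** Both lists are strictly increasing and have the same members, and a strictly increasing list is
    determined by its members. *)
Lemma map_enum_monotone (r q : nat) (f : 'I_r -> 'I_q) :
  (forall i j, (f i < f j)%N = (i < j)%N) ->
  map f (enum 'I_r) = [seq c <- enum 'I_q | c \in codom f].
Proof.
move=> f_mono.
apply: (irr_sorted_eq (@ord_ltn_trans q)) => [a | | |].
- exact: ltnn.
- rewrite sorted_map; apply: sub_sorted (sorted_enum_ord 'I_r) => a b /=.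
  by rewrite f_mono.
- by apply: sorted_filter (sorted_enum_ord 'I_q); apply: ord_ltn_trans.
by move=> c; rewrite mem_filter mem_enum andbT codomE.
Qed.

(** * Lowest nonzero entries *)

Variable F : fieldType.

Lemma low_SomeP (p : nat) (c : 'cV[F]_p) (r : 'I_p) :
  low c = Some r -> c r 0 != 0 /\ forall s : 'I_p, (r < s)%N -> c s 0 = 0.
Proof.
rewrite /low; case: pickP => // x /andP[cx /forallP h] [<-]; split=> // s xs.
by apply/eqP; have /implyP := h s; apply.
Qed.

Lemma low_None (p : nat) (c : 'cV[F]_p) : low c = None -> c = 0.
Proof.
rewrite /low; case: pickP => // h _.
apply/eqP; apply: contraT => /eqP c_neq0.
have [r0 cr0] : exists r, c r 0 != 0.
  apply/existsP; apply: contraT; rewrite negb_exists => /forallP c0.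
  case: c_neq0; apply/colP => r; rewrite mxE.
  by apply/eqP; have := c0 r; rewrite negbK.
case: (@arg_maxnP _ r0 (fun r => c r 0 != 0) (fun r => r : nat) cr0) => r cr rmax.
move: (h r); rewrite cr /= => /negbT; rewrite negb_forall => /existsP[s].
rewrite negb_imply => /andP[rs cs]; have := rmax s cs.
by rewrite /geq /= leqNgt rs.
Qed.

Lemma low0 (p : nat) : low (0 : 'cV[F]_p) = None.
Proof. by rewrite /low; case: pickP => // x; rewrite mxE eqxx. Qed.

(** * Column operations and termination of the reduction *)

Section Steps.

Variables p q n : nat.
Implicit Types (A B : 'M[F]_(p, q)) (S T : 'M[F]_(p, q) * 'M[F]_(n, q)).
Implicit Types (i j c : 'I_q).

Lemma col_sub_col (d : nat) (M : 'M[F]_(d, q)) i j lam c :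
  col c (sub_col i j lam M) = if c == i then col i M - lam *: col j M else col c M.
Proof. by apply/colP => r; rewrite !mxE; case: ifP => _; rewrite !mxE. Qed.

Lemma earlier_same_low_SomeP A i j : earlier_same_low A i = Some j ->
  [/\ (j < i)%N, low (col j A) = low (col i A) & low (col i A) != None].
Proof. by rewrite /earlier_same_low; case: pickP => // x /and3P[? /eqP ? ?] [<-]. Qed.

Lemma earlier_same_low_NoneP A i j : earlier_same_low A i = None ->
  (j < i)%N -> low (col j A) = low (col i A) -> low (col i A) = None.
Proof.
rewrite /earlier_same_low; case: pickP => // h _ ji e; apply/eqP.
by have := h j; rewrite ji e eqxx /= => /negbFE.
Qed.

Lemma eq_earlier_same_low A B i :
  (forall c, (c <= i)%N -> col c A = col c B) ->
  earlier_same_low A i = earlier_same_low B i.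
Proof.
move=> eqAB; apply: eq_pick => j; rewrite (eqAB i) //.
by case: ltnP => //= /ltnW /eqAB ->.
Qed.

Lemma reduction_step_col S i c : c != i ->
  col c (reduction_step i S).1 = col c S.1 /\ col c (reduction_step i S).2 = col c S.2.
Proof.
move=> ci; rewrite /reduction_step; case: earlier_same_low => [j|] //=.
by rewrite !col_sub_col (negPf ci).
Qed.

Lemma reduce_column_col S i c : c != i ->
  col c (reduce_column i S).1 = col c S.1 /\ col c (reduce_column i S).2 = col c S.2.
Proof.
move=> ci; rewrite /reduce_column; set N := (X in iter X); clearbody N.
elim: N => [|t [IH1 IH2]] //=.
by have [-> ->] := reduction_step_col (iter t (reduction_step i) S) ci.
Qed.

(** Allowing an arbitrary list of columns gives access to the intermediate states of the run, after
    a prefix of [enum 'I_q]. *)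
Definition reduce_columns (s : seq 'I_q) S := foldl (fun T i => reduce_column i T) S s.

Lemma reduce_columns_rcons s S i :
  reduce_columns (rcons s i) S = reduce_column i (reduce_columns s S).
Proof. exact: foldl_rcons. Qed.

Lemma reduce_columns_col s S c : c \notin s ->
  col c (reduce_columns s S).1 = col c S.1 /\ col c (reduce_columns s S).2 = col c S.2.
Proof.
elim: s S => [|i s IH] S //=; rewrite inE negb_or => /andP[ci cs].
have [-> ->] := IH (reduce_column i S) cs.
exact: reduce_column_col.
Qed.

(** Termination measure: the shift by one reserves 0 for the zero column, so values range from 0 to
    [p]. *)
Definition height (v : 'cV[F]_p) : nat := if low v is Some r then r.+1 else 0%N.

Lemma height_le (v : 'cV[F]_p) (t : nat) :
  (forall r : 'I_p, (t <= r)%N -> v r 0 = 0) -> (height v <= t)%N.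
Proof.
rewrite /height => v0; case E: (low v) => [r|] //.
have [vr _] := low_SomeP E; rewrite ltnNge.
by apply: contraNN vr => /v0 ->.
Qed.

(** Columns [i] and [j] both vanish below their common lowest row, and the quotient of their lowest
    entries is chosen to cancel the entry in that row. *)
Lemma reduction_step_height S i j : earlier_same_low S.1 i = Some j ->
  (height (col i (reduction_step i S).1) < height (col i S.1))%N.
Proof.
move=> E; have [ji] := earlier_same_low_SomeP E.
rewrite /reduction_step E /= col_sub_col eqxx /lowest_entry.
rewrite {2}/height; case Ei: (low (col i S.1)) => [r|] // Ej _; rewrite Ej ltnS.
have [ir ir0] := low_SomeP Ei; have [jr jr0] := low_SomeP Ej.
apply: height_le => s; rewrite leq_eqVlt => /predU1P[/val_inj <- | rs].
  by move: jr; rewrite !mxE => jr; rewrite divfK ?subrr.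
by move: (ir0 s rs) (jr0 s rs); rewrite !mxE => -> ->; rewrite mulr0 subr0.
Qed.

Lemma reduce_column_done S i : earlier_same_low (reduce_column i S).1 i = None.
Proof.
pose U t := iter t (reduction_step i) S.
(* After [t] steps the loop has stopped or the height is at most [p - t]. For [t = p] the second
   case forces a zero column, where the loop stops as well. *)
have step t : earlier_same_low (U t).1 i = None \/ (height (col i (U t).1) + t <= p)%N.
  elim: t => [|t [IH|IH]].
  - by right; rewrite addn0; apply: height_le => r; rewrite leqNgt ltn_ord.
  - by left; rewrite /U iterS /reduction_step -/(U t) IH.
  case E: (earlier_same_low (U t).1 i) => [j|].
    right; rewrite addnS; apply: leq_trans IH.
    by rewrite ltn_add2r /U iterS; apply: reduction_step_height E.
  by left; rewrite /U iterS /reduction_step -/(U t) E.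
rewrite /reduce_column -/(U p); case: (step p) => // hp.
case E: (earlier_same_low (U p).1 i) => [j|] //.
have [_ _] := earlier_same_low_SomeP E.
have: (height (col i (U p).1) <= 0)%N by rewrite -(leq_add2r p).
by rewrite leqn0 /height; case: low.
Qed.

Lemma enum_ord_cat_lt (s1 s2 : seq 'I_q) i j :
  enum 'I_q = s1 ++ i :: s2 -> (j <= i)%N -> j \notin s2.
Proof.
move=> e ji; have := sorted_enum_ord 'I_q.
rewrite e (sorted_pairwise (@ord_ltn_trans q)) pairwise_cat => /and3P[_ _ /=/andP[/allP h _]].
by apply: contraL ji => /h; rewrite -ltnNge.
Qed.

Lemma enum_ord_split i : exists s1 s2, enum 'I_q = s1 ++ i :: s2.
Proof.
have := mem_enum 'I_q i; rewrite inE.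
by case/splitPr => s1 s2; exists s1, s2.
Qed.

Lemma column_reduction_col S s1 s2 i c : enum 'I_q = s1 ++ i :: s2 -> (c <= i)%N ->
  col c (column_reduction S).1 = col c (reduce_column i (reduce_columns s1 S)).1.
Proof.
move=> e ci; rewrite /column_reduction e foldl_cat /=.
by have [] := reduce_columns_col (reduce_column i (reduce_columns s1 S))
                (enum_ord_cat_lt e ci).
Qed.

(** The search at [i] reads only columns up to [i], and these are final once column [i] has been
    processed. Over all [i] this says that nonzero reduced columns have distinct lows. *)
Lemma column_reduction_done S i : earlier_same_low (column_reduction S).1 i = None.
Proof.
have [s1 [s2 e]] := enum_ord_split i.
rewrite -(reduce_column_done (reduce_columns s1 S) i).
by apply: eq_earlier_same_low => c; apply: column_reduction_col e.
Qed.

(** * Spans of initial segments of columns *)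

Definition col_span (t : nat) A : {vspace 'cV[F]_p} :=
  (\sum_(c < q | (c < t)%N) <[col c A]>)%VS.

Lemma memv_col_span (t : nat) A c : (c < t)%N -> col c A \in col_span t A.
Proof.
by move=> ct; apply: (subvP (sumv_sup c ct (subvv _))); rewrite memv_line.
Qed.

Lemma col_span_sub_col_le t A i j lam : (j < i)%N ->
  (col_span t (sub_col i j lam A) <= col_span t A)%VS.
Proof.
move=> ji; apply/subv_sumP => c ct; rewrite -memvE col_sub_col.
case: eqP => [ci|_]; last exact: memv_col_span.
rewrite ci in ct; apply: rpredB; first exact: memv_col_span.
by apply: rpredZ; apply: memv_col_span; apply: ltn_trans ct.
Qed.

(** The operation is undone by the one with scalar [- lam], so one inclusion, applied twice, gives
    equality. *)
Lemma col_span_sub_col t A i j lam : (j < i)%N ->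
  col_span t (sub_col i j lam A) = col_span t A.
Proof.
move=> ji; apply/eqP; rewrite eqEsubv col_span_sub_col_le //=.
suff eA : A = sub_col i j (- lam) (sub_col i j lam A).
  by rewrite {1}eA; apply: col_span_sub_col_le.
have ne : j != i by apply: contraTneq ji => ->; rewrite ltnn.
apply/matrixP => r c; rewrite !mxE eqxx (negPf ne).
by case: eqP => [->|//]; rewrite mulNr opprK subrK.
Qed.

Lemma col_span_reduce_column t S i : col_span t (reduce_column i S).1 = col_span t S.1.
Proof.
rewrite /reduce_column; set N := (X in iter X); clearbody N.
elim: N => [|u IH] //=; rewrite -{}IH /reduction_step.
case E: earlier_same_low => [j|] //=.
by rewrite col_span_sub_col //; case: (earlier_same_low_SomeP E).
Qed.

Lemma col_span_column_reduction t S : col_span t (column_reduction S).1 = col_span t S.1.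
Proof.
rewrite /column_reduction; elim: (enum _) S => [|i s IH] S //=.
by rewrite IH col_span_reduce_column.
Qed.

Lemma col_spanS A c : col_span c.+1 A = (<[col c A]> + col_span c A)%VS.
Proof.
rewrite /col_span (bigD1 c) //=; congr (_ + _)%VS; apply: eq_bigl => d.
by rewrite ltnS [RHS]ltn_neqAle andbC.
Qed.

(* In a sum of columns with distinct lows, the entry in the lowest row involved
   comes from a single column, so nothing can cancel it. *)
Lemma distinct_low_free A (a : 'I_q -> F) :
  (forall c, earlier_same_low A c = None) ->
  \sum_c a c *: col c A = 0 -> forall c, a c *: col c A = 0.
Proof.
move=> distinct sum0 c0; apply/eqP; apply: contraT => nz0.
case: (@arg_maxnP _ c0 (fun c => a c *: col c A != 0)
  (fun c => height (col c A)) nz0) => c nz cmax.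
have nzc : col c A != 0 by apply: contraNneq nz => ->; rewrite scaler0.
have nza : a c != 0 by apply: contraNneq nz => ->; rewrite scale0r.
case E: (low (col c A)) => [r|]; last by rewrite (low_None E) eqxx in nzc.
have [cr _] := low_SomeP E.
move/colP/(_ r): sum0; rewrite summxE (bigD1 c) //= big1 => [|d dc].
  by rewrite addr0 mxE [X in _ = X]mxE => /eqP; rewrite mulf_eq0 (negPf nza) (negPf cr).
case: (eqVneq (a d *: col d A) 0) => [->|nzd]; first by rewrite mxE.
have := cmax d nzd; rewrite /geq /= /height E.
case Ed: (low (col d A)) => [s|]; last by rewrite mxE (low_None Ed) mxE mulr0.
have [_ ds] := low_SomeP Ed; rewrite ltnS leq_eqVlt => /predU1P[/val_inj sr|sr].
  (* Equal lows in two different columns: the later of the two would find the other in its search,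
     against [distinct]. *)
  rewrite sr in Ed; exfalso; move: dc; rewrite -val_eqE neq_ltn => /orP[] lt.
    by have := earlier_same_low_NoneP (distinct c) lt (etrans Ed (esym E)); rewrite E.
  by have := earlier_same_low_NoneP (distinct d) lt (etrans E (esym Ed)); rewrite Ed.
by rewrite mxE ds ?mulr0.
Qed.

Lemma column_reduction_eq0 S c :
  col c S.1 \in col_span c S.1 -> col c (column_reduction S).1 = 0.
Proof.
move=> cS; set R := (column_reduction S).1.
have : col c R \in col_span c R.
  rewrite col_span_column_reduction.
  (* By hypothesis column [c] adds nothing to the span of its predecessors. The span through [c] is
     preserved by the reduction and contains the reduced column [c]. *)
  suff -> : col_span c S.1 = col_span c.+1 S.1.
    by rewrite -(col_span_column_reduction c.+1); apply: memv_col_span.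
  by rewrite col_spanS; apply/esym/addv_idPr; rewrite -memvE.
case/memv_sumP => v vP e.
have aP (d : 'I_q) : exists x, (d < c)%N -> v d = x *: col d R.
  case: (ltnP d c) => [dc|_]; last by exists 0.
  by have /vlineP[x ->] := vP d dc; exists x.
have [a aE] := fin_all_exists aP.
(* Membership in the span becomes a linear relation among all columns, with coefficient -1 at [c]
   and 0 after it; independence then kills the term at [c]. *)
pose b d := if d == c then -1 else if (d < c)%N then a d else 0.
have sum0 : \sum_d b d *: col d R = 0.
  rewrite (bigD1 c) //= {1}/b eqxx scaleN1r e addrC; apply/eqP; rewrite subr_eq0.
  rewrite big_mkcond [X in _ == X]big_mkcond; apply/eqP/eq_bigr => d _; rewrite /b.
  case: (eqVneq d c) => [->|dc] /=; first by rewrite ltnn.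
  by case: ifP => dc'; rewrite ?scale0r ?aE.
have := distinct_low_free (column_reduction_done S) sum0 c.
by rewrite /b eqxx scaleN1r => /eqP; rewrite oppr_eq0 => /eqP.
Qed.

End Steps.

(** * Deleting columns that reduce to zero *)

Section Simulation.

Variables (p q r n : nat) (f : 'I_r -> 'I_q).
Hypothesis f_mono : forall i j, (f i < f j)%N = (i < j)%N.

Let restr (S : 'M[F]_(p, q) * 'M[F]_(n, q)) := (colsub f S.1, colsub f S.2).

Lemma monotone_ord_inj : injective f.
Proof.
move=> i j e; apply: val_inj.
by case: (ltngtP i j) => //; rewrite -f_mono e ltnn.
Qed.

Lemma col_colsub (d : nat) (M : 'M[F]_(d, q)) i : col i (colsub f M) = col (f i) M.
Proof. by apply/colP => x; rewrite !mxE. Qed.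

(* [pick] selects the least candidate and f is monotone, so it suffices that every
   candidate lies in the image of f. *)
Lemma earlier_same_low_colsub (A : 'M[F]_(p, q)) i :
  (forall c : 'I_q, (c < f i)%N -> c \notin codom f -> col c A = 0) ->
  earlier_same_low A (f i) = omap f (earlier_same_low (colsub f A) i).
Proof.
move=> A0; case E: (earlier_same_low A (f i)) => [c|]; last first.
  case E': earlier_same_low => [j|] //=.
  have [ji] := earlier_same_low_SomeP E'; rewrite !col_colsub => ej.
  rewrite -(f_mono j i) in ji; have := earlier_same_low_NoneP E ji ej.
  by move=> ->.
have [ci ec nc] := earlier_same_low_SomeP E.
have /codomP[j cj] : c \in codom f.
  apply: contraT => /(A0 _ ci) c0.
  by rewrite -ec c0 low0 in nc.
subst c; rewrite f_mono in ci.
case E': (earlier_same_low (colsub f A) i) => [j'|] /=; last first.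
  have := earlier_same_low_NoneP E' ci; rewrite !col_colsub => /(_ ec) h.
  by rewrite h in nc.
have [j'i ej' _] := earlier_same_low_SomeP E'; rewrite !col_colsub in ej'.
congr (Some (f _)); apply/val_inj/eqP; rewrite eqn_leq.
apply/andP; split; last first.
  by apply: (pick_ord_min E'); rewrite /= ci !col_colsub ec eqxx.
rewrite leqNgt -(f_mono j' j) -leqNgt.
by apply: (pick_ord_min E); rewrite /= f_mono j'i ej' eqxx.
Qed.

Lemma colsub_sub_col (d : nat) (M : 'M[F]_(d, q)) i j lam :
  colsub f (sub_col (f i) (f j) lam M) = sub_col i j lam (colsub f M).
Proof. by apply/matrixP => x c; rewrite !mxE (inj_eq monotone_ord_inj). Qed.

Lemma reduction_step_restr S i :
  (forall c : 'I_q, (c < f i)%N -> c \notin codom f -> col c S.1 = 0) ->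
  restr (reduction_step (f i) S) = reduction_step i (restr S).
Proof.
move=> S0; rewrite /reduction_step (earlier_same_low_colsub S0) /=.
by case: earlier_same_low => [j|] //=; rewrite /restr /= !colsub_sub_col !col_colsub.
Qed.

Lemma reduce_column_restr S i :
  (forall c : 'I_q, (c < f i)%N -> c \notin codom f -> col c S.1 = 0) ->
  restr (reduce_column (f i) S) = reduce_column i (restr S).
Proof.
move=> S0; rewrite /reduce_column.
(* The vanishing of the omitted columns is carried along the induction; it persists because only
   column [f i] changes. *)
suff: forall t, restr (iter t (reduction_step (f i)) S)
        = iter t (reduction_step i) (restr S) /\
      forall c : 'I_q, (c < f i)%N -> c \notin codom f ->
        col c (iter t (reduction_step (f i)) S).1 = 0.
  by move=> /(_ p)[].
elim=> [|t [IH IH0]] //=; split; first by rewrite reduction_step_restr // IH.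
move=> c ci cf; have ne : c != f i by apply: contraTneq ci => ->; rewrite ltnn.
by have [-> _] := reduction_step_col (iter t (reduction_step (f i)) S) ne; apply: IH0.
Qed.

(** Reducing an omitted column changes that column alone, which the restriction does not see. *)
Lemma reduce_column_restr_out S c : c \notin codom f ->
  restr (reduce_column c S) = restr S.
Proof.
move=> cf; have h i : f i != c by apply: contraNneq cf => <-; apply: codom_f.
by congr pair; apply/matrixP => x i;
  have [/colP e1 /colP e2] := reduce_column_col S (h i);
  [have := e1 x | have := e2 x]; rewrite !mxE.
Qed.

Lemma column_reduction_colsub (A : 'M[F]_(p, q)) (W : 'M[F]_(n, q)) :
  (forall c, c \notin codom f -> col c (column_reduction (A, W)).1 = 0) ->
  column_reduction (colsub f A, colsub f W)
    = (colsub f (column_reduction (A, W)).1, colsub f (column_reduction (A, W)).2).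
Proof.
move=> R0; set S := (A, W) in R0 *; rewrite -[RHS]/(restr _).
rewrite -[X in column_reduction X]/(restr S).
(* The two runs are compared prefix by prefix: [t] lists the kept columns among those of [s1], in
   the indexing of the smaller matrix. *)
suff sim s1 : forall s2 t, enum 'I_q = s1 ++ s2 ->
    map f t = [seq c <- s1 | c \in codom f] ->
    restr (reduce_columns s1 S) = reduce_columns t (restr S).
  by apply/esym/(sim _ [::]); [rewrite cats0 | apply: map_enum_monotone].
elim/last_ind: s1 => [|s1 c IH] s2 t; first by case: t.
rewrite cat_rcons filter_rcons => e.
have IH' := IH _ _ e.
rewrite reduce_columns_rcons.
case: ifPn => [/codomP[i ci]|cf] et; last by rewrite reduce_column_restr_out //; apply: IH'.
move: et; case/lastP: t => [|t i']; first by case: (filter _ _).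
rewrite map_rcons => /rcons_inj[et ei].
have -> : i' = i by apply: monotone_ord_inj; rewrite ei.
rewrite reduce_columns_rcons -(IH' _ et) ci; apply: reduce_column_restr => d dc df.
(* [R0] concerns the final matrix, but an omitted column [d] before [c] has already been processed,
   so it has its final value 0 at this stage. *)
have := R0 d df; rewrite -ci in dc; rewrite (column_reduction_col S e (ltnW dc)).
have ne : d != c by apply: contraTneq dc => ->; rewrite ltnn.
by have [-> _] := reduce_column_col (reduce_columns s1 S) ne.
Qed.

End Simulation.

End Reduction.

(** * Birth simplices and the boundary matrix of one dimension *)

Section Birth.

Set Implicit Arguments.
Unset Strict Implicit.
Unset Printing Implicit Defensive.

Import GRing.Theory.
Local Open Scope ring_scope.

Variables (F : fieldType) (disp : Order.disp_t) (V : finOrderType disp).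

Lemma incidence_eq0 (t s : {set V}) : #|s| != #|t|.+1 -> incidence F t s = 0.
Proof.
move=> ne; rewrite /incidence big1 // => v /andP[vs /eqP tE].
by move: ne; rewrite tE (cardsD1 v s) vs add1n eqxx.
Qed.

Variables (K : {set {set V}}) (m : nat).
Variables (Kf : nat -> {set {set V}}) (sigma : 'I_m -> {set V}).
Hypothesis hKf : simplexwise_filtration K Kf sigma.

(** The filtration is increasing, so for [i <= j] the simplex [sigma j] would already lie in [Kf j],
    although it is new at that stage. *)
Lemma filtration_mem_lt (i j : 'I_m) : sigma j \in Kf i -> (j < i)%N.
Proof.
move=> ji; rewrite ltnNge; apply/negP => le_ij.
have mono d : (i + d <= j)%N -> Kf i \subset Kf (i + d).
  elim: d => [|d IH]; first by rewrite addn0 subxx.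
  rewrite addnS => lt; apply: (subset_trans (IH (ltnW lt))).
  have ltm : (i + d < m)%N := ltn_trans lt (ltn_ord j).
  by rewrite (filtration_step hKf (Ordinal ltm)) subsetUr.
have := mono (j - i)%N; rewrite subnKC // leqnn => /(_ isT)/subsetP/(_ _ ji).
by apply/negP; apply: filtration_new hKf j.
Qed.

(** [death] is defined with boundaries in all dimensions. Restriction to the rows of the [k]-th
    boundary matrix is linear, so it carries the dependence over to that matrix. *)
Lemma birth_col_span (k : nat) (c : 'I_#|simplices sigma k.+1|) :
  birth F Kf sigma (enum_val c) ->
  col c (boundary_matrix F sigma k) \in col_span c (boundary_matrix F sigma k).
Proof.
set B := boundary_matrix F sigma k; set i := enum_val c.
pose rs : 'I_#|simplices sigma k| -> 'I_m := enum_val.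
have colE (d : 'I_#|simplices sigma k.+1|) :
    col d B = rowsub rs (col (enum_val d) (total_boundary F sigma)).
  by apply/colP => x; rewrite !mxE.
rewrite /birth /death negbK.
move=> /(memv_img (linfun (rowsub rs))).
rewrite lfunE /= -colE limg_span; apply: subvP.
apply/span_subvP => _ /mapP[_ /mapP[j + ->] ->].
rewrite mem_filter => /andP[/filtration_mem_lt ji _]; rewrite lfunE /=.
case: (boolP (j \in simplices sigma k.+1)) => jk.
  rewrite -(enum_rankK_in jk jk) -colE; apply: memv_col_span.
  by rewrite -enum_val_ltn enum_rankK_in.
(* Simplices of other dimensions contribute nothing, having no face among the simplices that label
   the rows. *)
suff -> : rowsub rs (col j (total_boundary F sigma)) = 0 by apply: mem0v.
apply/colP => x; rewrite !mxE incidence_eq0 //.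
have := enum_valP x; rewrite !inE in jk * => /eqP e.
by rewrite [#|sigma (rs x)|]e.
Qed.

(** All death columns are kept, so an omitted column is a birth column and reduces to zero. Both
    runs start from the same chains, so the matrices of the [v_i] are compared too. *)
Lemma reduced_D_colsub (k : nat) :
  reduced_D F Kf sigma k = (colsub enum_val (reduced_boundary F sigma k).1,
                            colsub enum_val (reduced_boundary F sigma k).2).
Proof.
apply: column_reduction_colsub => [b b'|c cf]; first exact: enum_val_ltn.
apply: column_reduction_eq0; apply: birth_col_span.
apply: contraNT cf; rewrite /birth negbK => dc.
have ck : c \in kept_columns F Kf sigma k by rewrite inE dc.
by rewrite -(enum_rankK_in ck ck) codom_f.
Qed.

End Birth.

Theorem mainTheorem2 (F : fieldType) (disp : Order.disp_t)
    (V : finOrderType disp) (K : {set {set V}}) (m : nat)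
    (Kf : nat -> {set {set V}}) (sigma : 'I_m -> {set V})
    (hK : simplicial_complex K)
    (hKf : simplexwise_filtration K Kf sigma)
    (k : nat) (i : 'I_m) (hi : #|sigma i| = k.+1) :
  (death F Kf sigma i ->
     exists (a : 'I_#|simplices sigma k.+1|)
            (b : 'I_#|kept_columns F Kf sigma k|),
       [/\ boundary_label a = i, D_label b = i &
           col b (reduced_D F Kf sigma k).1
           = col a (reduced_boundary F sigma k).1]) /\
  (essential F Kf sigma i ->
     exists (a : 'I_#|simplices sigma k.+1|)
            (b : 'I_#|kept_columns F Kf sigma k|),
       [/\ boundary_label a = i, D_label b = i &
           col b (reduced_D F Kf sigma k).2
           = col a (reduced_boundary F sigma k).2]).
Proof.
have ik : i \in simplices sigma k.+1 by rewrite inE hi eqxx.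
pose a := enum_rank_in ik i.
have ai : enum_val a = i by apply: enum_rankK_in.
(* Both claims now need only the position of [i] among the kept columns; the equalities of columns
   are read off from [reduced_D_colsub]. *)
suff labels : death F Kf sigma i || essential F Kf sigma i ->
    exists b : 'I_#|kept_columns F Kf sigma k|, enum_val b = a.
  split=> kept; have [|b ba] := labels; rewrite ?kept ?orbT //;
    exists a, b; rewrite (reduced_D_colsub F hKf) /= col_colsub;
    by rewrite /D_label /boundary_label ba ai.
move=> kept; have ak : a \in kept_columns F Kf sigma k by rewrite inE ai.
by exists (enum_rank_in ak a); apply: enum_rankK_in.
Qed.
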